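(* For any $a\in\mathbb{N}$ and $b,c\in\mathbb{N}_0$, $$t^{\star}(\{2\}^{a},1,\{2\}^{b},3,\{2\}^{c})=-\frac{4}{\pi}t(\overline{2a+2b+2c+5})-\frac{8}{\pi}t(2a+1,\overline{2b+2c+4})-\frac{8}{\pi}t(\overline{2a+2b+3},2c+2)-\frac{16}{\pi}t(2a+1,\overline{2b+2},2c+2)$$ and $$t^{\star}(\{2\}^{a},1,\{2\}^{b},1,\{2\}^{c})=-\frac{4}{\pi}t(\overline{2a+2b+2c+3})-\frac{8}{\pi}t(2a+1,\overline{2b+2c+2})-\frac{8}{\pi}t(2a+2b+2,\overline{2c+1})-\frac{16}{\pi}t(2a+1,2b+1,\overline{2c+1}).$$
   Context: $t^{\star}(\boldsymbol{s})=\sum_{k_1\geq\cdots\geq k_r\geq1}\prod_{j}(2k_j-1)^{-s_j}$ for an index with $s_1>1$; $\{2\}^a$ is $2$ repeated $a$ times. Alternating multiple $t$-values: $t(\boldsymbol{s};\boldsymbol{\sigma})=\sum_{k_1>\cdots>k_r\geq1}\prod_{j}\frac{\sigma_j^{k_j}}{(2k_j-1)^{s_j}}$, where a bar over $s_j$ means $\sigma_j=-1$ and no bar means $\sigma_j=1$. *)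

(* Defs.v *)
From HB Require Import structures.
From mathcomp Require Import all_boot all_order all_algebra.
From mathcomp Require Import all_classical all_reals all_analysis.
Import Order.TTheory GRing.Theory Num.Theory numFieldNormedType.Exports.
Local Open Scope ring_scope.

Fixpoint tstarN (R : realType) (s : seq nat) (N : nat) : R :=
  match s with
  | [::] => 1
  | s1 :: r => \sum_(1 <= k < N.+1) ((2 * k - 1)%N%:R ^- s1) * tstarN R r k
  end.

(* Truncated alternating multiple t-value; index entries (s_j, bar_j), where
   bar_j = true means sigma_j = -1:
   tN s N = sum_{N >= k1 > ... > kr >= 1} prod_j sigma_j^{k_j} / (2 k_j - 1)^{s_j}. *)
Fixpoint tN (R : realType) (s : seq (nat * bool)) (N : nat) : R :=
  match s with
  | [::] => 1
  | (s1, b1) :: r =>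
      \sum_(1 <= k < N.+1)
        ((if b1 then (-1) ^+ k else 1) * (2 * k - 1)%N%:R ^- s1) * tN R r k.-1
  end.

Definition tstar (R : realType) (s : seq nat) : R := limn (tstarN R s : R^nat).
Definition altt (R : realType) (s : seq (nat * bool)) : R := limn (tN R s : R^nat).

(* Main.v *)
Require Import Defs.
From HB Require Import structures.
From mathcomp Require Import all_boot all_order all_algebra.
From mathcomp Require Import all_classical all_reals all_analysis.
From mathcomp Require Import ring lra zify.
Import Order.TTheory GRing.Theory Num.Theory numFieldNormedType.Exports.
Local Open Scope classical_set_scope.
Local Open Scope ring_scope.

(** Expand the truncated star sums in partial fractions.  Put
    A(n,k) = prod_(j <= n, j <> k) (1 - (2k-1)^2 / (2j-1)^2)^-1.
    Then 1 = sum_k A(n,k), and A(n,k) - A(n-1,k) = A(n,k) (2k-1)^2 / (2n-1)^2.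
    Hence, if f(n) = sum_k A(n,k) g(k), prepending 2, 1 or 3 to the index, i.e.
    replacing f(n) by sum_(j <= n) f(j) / (2j-1)^s, replaces g(k) respectively by
    g(k) / (2k-1)^2,
    (-1)^k (2 sum_(i < k) u(i) + u(k)) with u(i) = (-1)^i g(i) / (2i-1),
    (2k-1)^-1 (2 sum_(i < k) u(i) + u(k)) with u(i) = g(i) / (2i-1)^2,
    the last two by Abel summation against hypergeometric telescopers.  The
    resulting g is a combination of truncated alternating t-sums.  Finally
    A(n,k) tends to (4 / pi) (-1)^(k-1) / (2k-1), the constant being forced by
    sum_k A(n,k) = 1 and the Leibniz series, and since |A(n,k)| <= (3/2) / (2k-1)
    and g(k) = O(1 / k), dominated convergence gives the limit. *)

Section MultipleTStar.
Variable R : realType.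

(** * The coefficients of the expansion and their recurrences *)

Definition oddr (i : nat) : R := 2 * i%:R + 1.

(* [coefA m i] is A(n,k) of the header for n = m + 1 and k = i + 1; it vanishes
   for i > m.  The recursion in i avoids the factors j <> k. *)
Fixpoint coefA (m i : nat) : R :=
  match i with
  | 0 => \prod_(j < m) (oddr j.+1 ^+ 2 / (4 * j.+1%:R * j.+2%:R))
  | j.+1 => - (oddr j * (m%:R - j%:R)) /
              (oddr j.+1 * (m%:R + j%:R + 2)) * coefA m j
  end.

Arguments coefA : simpl never.

Lemma oddr_gt0 i : 0 < oddr i.
Proof. by rewrite /oddr; have := ler0n R i; lra. Qed.

Lemma oddr_neq0 i : oddr i != 0.
Proof. by rewrite lt0r_neq0 // oddr_gt0. Qed.

Lemma oddrE i : (2 * i.+1 - 1)%N%:R = oddr i.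
Proof. by rewrite mulnS addSn subn1 /= add1n mulrSr natrM. Qed.

Lemma coefAS m i :
  oddr i.+1 * (m%:R + i%:R + 2) * coefA m i.+1 =
  - (oddr i * (m%:R - i%:R)) * coefA m i.
Proof.
rewrite /coefA -/(coefA m i).
have := oddr_neq0 i.+1; set o := oddr i.+1 => o0.
have := ler0n R m; have := ler0n R i => i0 m0.
by field; rewrite o0 andbT; apply: lt0r_neq0; lra.
Qed.

(** The factor [4 * (m + 1 - i) * (m + i + 2)] is [oddr m.+1 ^+ 2 - oddr i ^+ 2], so going from [m]
    to [m.+1] multiplies in one new factor of the product. Without division the relation also covers
    [i = m.+1], where both sides vanish. *)
Lemma coefA_rec m i :
  oddr m.+1 ^+ 2 * coefA m i =
  4 * (m%:R + 1 - i%:R) * (m%:R + i%:R + 2) * coefA m.+1 i.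
Proof.
have m0 := ler0n R m.
elim: i => [|i IH].
  rewrite /coefA big_ord_recr /=; set P := \prod_(i < m) _.
  have : m.+1%:R = m%:R + 1 :> R by rewrite mulrSr.
  have : m.+2%:R = m%:R + 2 :> R by rewrite -natrD addn2.
  move=> -> -> /=; field; apply/andP; split; apply: lt0r_neq0; lra.
have i0 := ler0n R i.
have h1 : m%:R + i%:R + 2 != 0 :> R by apply: lt0r_neq0; lra.
have h2 : m%:R + 1 + i%:R + 2 != 0 :> R by apply: lt0r_neq0; lra.
have e1 : m.+1%:R = m%:R + 1 :> R by rewrite mulrSr.
have e2 : i.+1%:R = i%:R + 1 :> R by rewrite mulrSr.
rewrite /coefA -/(coefA m i) -/(coefA m.+1 i) mulrCA IH e1 e2.
by field; rewrite h1 h2 oddr_neq0.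
Qed.

Lemma coefA_recB m i :
  oddr m.+1 ^+ 2 * (coefA m.+1 i - coefA m i) = oddr i ^+ 2 * coefA m.+1 i.
Proof.
rewrite mulrBr coefA_rec /oddr.
have -> : m.+1%:R = m%:R + 1 :> R by rewrite mulrSr.
ring.
Qed.

Lemma coefA_gt m i : (m < i)%N -> coefA m i = 0.
Proof.
elim: i => // i IH; rewrite ltnS leq_eqVlt /coefA -/(coefA m i).
by move=> /predU1P[<-|/IH ->]; rewrite ?mulr0 // subrr mulr0 oppr0 !mul0r.
Qed.

Lemma coefA00 : coefA 0 0 = 1.
Proof. by rewrite /coefA big_ord0. Qed.

(** * Expansions and the effect of prepending an entry *)

Definition expands (s : seq nat) (g : nat -> R) :=
  forall m, tstarN R s m.+1 = \sum_(i < m.+1) coefA m i * g i.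

Lemma sum_coefA_recB (h : nat -> R) m :
  oddr m.+1 ^+ 2 * (\sum_(i < m.+2) coefA m.+1 i * h i
                       - \sum_(i < m.+1) coefA m i * h i) =
  \sum_(i < m.+2) coefA m.+1 i * oddr i ^+ 2 * h i.
Proof.
have -> : \sum_(i < m.+1) coefA m i * h i = \sum_(i < m.+2) coefA m i * h i.
  by rewrite [RHS]big_ord_recr /= coefA_gt // mul0r addr0.
rewrite -sumrB mulr_sumr; apply: eq_bigr => i _.
by rewrite -mulrBl mulrA coefA_recB; ring.
Qed.

(** Both sides of the expansion of [s :: r] are compared through their increments in [m]. Scaled by
    [oddr m ^+ 2], these are the two sides of the second hypothesis, the right one by
    [sum_coefA_recB]; the case [m = 0] gives the initial value. *)
Lemma expands_cons (s : nat) (r : seq nat) (g h : nat -> R) :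
  expands r g ->
  (forall m, oddr m ^+ 2 * oddr m ^- s * \sum_(i < m.+1) coefA m i * g i =
             \sum_(i < m.+1) coefA m i * oddr i ^+ 2 * h i) ->
  expands (s :: r) h.
Proof.
move=> rg gh; elim=> [|m IH].
  have := gh 0; rewrite /= big_nat1 rg !big_ord1 oddrE coefA00.
  have -> : oddr 0 = 1 by rewrite /oddr mulr0 add0r.
  by rewrite !expr1n invr1 !mul1r.
have -> : tstarN R (s :: r) m.+2 =
    tstarN R (s :: r) m.+1 + oddr m.+1 ^- s * tstarN R r m.+2.
  by rewrite /= big_nat_recr //= oddrE.
rewrite IH rg; apply/(mulfI (expf_neq0 2 (oddr_neq0 m.+1))).
by rewrite mulrDr mulrA gh -sum_coefA_recB mulrBr addrC subrK.
Qed.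

Lemma expands_two r g :
  expands r g -> expands (2%N :: r) (fun i => oddr i ^- 2 * g i).
Proof.
move=> /expands_cons; apply => m.
rewrite divff ?expf_neq0 ?oddr_neq0 // mul1r; apply: eq_bigr => i _.
by rewrite mulrA mulfK // expf_neq0 ?oddr_neq0.
Qed.

Lemma expands_nseq_two a r g :
  expands r g -> expands (nseq a 2%N ++ r) (fun i => oddr i ^- (2 * a) * g i).
Proof.
move=> rg; elim: a => [|a IH] /=.
  by move=> m; rewrite rg; apply: eq_bigr => i _; rewrite muln0 expr0 invr1 mul1r.
move=> m; rewrite (expands_two _ _ IH); apply: eq_bigr => i _.
by rewrite [in LHS](mulrA (_ ^- 2)) -invfM -exprD mulnS addnC.
Qed.

(** By [sum_coefA_recB], constancy in [m] of the sum of the coefficients amounts to the vanishing of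
    the sum weighted by [oddr i ^+ 2], which telescopes. *)
Lemma expands_nil : expands [::] (fun=> 1).
Proof.
elim=> [|m IH].
  by rewrite big_ord1 coefA00 mulr1.
(* The right-hand side is the antidifference found by Gosper's algorithm. *)
have tel n : m.+1%:R * \sum_(i < n) coefA m.+1 i * oddr i ^+ 2 * 1 =
    - (n%:R * (m.+1%:R + n%:R + 1) * oddr n * coefA m.+1 n).
  elim: n => [|n IHn]; first by rewrite big_ord0 mulr0 !mul0r oppr0.
  rewrite big_ord_recr /= mulrDr IHn.
  have := coefAS m.+1 n; have -> : n.+1%:R = n%:R + 1 :> R by rewrite mulrSr.
  move: (coefA m.+1 n.+1) (oddr n.+1) (coefA m.+1 n) => x y z e.
  rewrite (_ : (n%:R + 1) * _ * _ * _ = (n%:R + 1) * (y * (m.+1%:R + n%:R + 2) * x));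
    last by ring.
  by rewrite e /oddr; ring.
(* Over the full range the antidifference ends at [coefA m.+1 m.+2 = 0]. *)
have /eqP := tel m.+2; rewrite -(sum_coefA_recB (fun=> 1)) -IH coefA_gt // mulr0 oppr0.
rewrite !mulf_eq0 pnatr_eq0 (negbTE (oddr_neq0 _)) /=.
by rewrite subr_eq0 => /eqP ->.
Qed.

(** A symmetric Abel summation: the two summands at [l] differ by
    [2 * H l * Q l - 2 * H l.+1 * Q l.+1]. *)
Lemma abel_telescope (H Q : nat -> R) n : Q 0%N = 0 ->
  \sum_(l < n) (H l - H l.+1) * (Q l + Q l.+1) =
  \sum_(l < n) (H l + H l.+1) * (Q l.+1 - Q l) - 2 * H n * Q n.
Proof.
move=> Q0; elim: n => [|n IH]; first by rewrite !big_ord0 Q0 mulr0 subrr.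
by rewrite !big_ord_recr /= IH; ring.
Qed.

(* This is 2 sum_(i < l) u i + u l, in the form required by Abel summation. *)
Definition starsum (u : nat -> R) (l : nat) : R :=
  \sum_(i < l) u i + \sum_(i < l.+1) u i.

(** Take for [Q] the partial sums of [u]: [starsum u l] is then [Q l + Q l.+1], and both boundary
    terms vanish. *)
Lemma sum_starsum m (u F G : nat -> R) (H : nat -> R) :
  H m.+1 = 0 ->
  (forall l, H l - H l.+1 = F l) -> (forall l, H l + H l.+1 = G l) ->
  \sum_(l < m.+1) F l * starsum u l = \sum_(l < m.+1) G l * u l.
Proof.
move=> Hm HF HG.
have := @abel_telescope H (fun l => \sum_(i < l) u i) m.+1 (big_ord0 _ _ _ _).
rewrite Hm mulr0 mul0r subr0.
under eq_bigr do rewrite HF -/(starsum u _).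
move=> ->; apply: eq_bigr => l _.
by rewrite HG big_ord_recr /= addrAC subrr add0r.
Qed.

Lemma expands_one r g : expands r g ->
  expands (1%N :: r)
    (fun l => (-1) ^+ l * starsum (fun i => (-1) ^+ i * (oddr i)^-1 * g i) l).
Proof.
move=> /expands_cons; apply => m.
rewrite mulfK ?oddr_neq0 // mulr_sumr.
(* This telescoper has [H l - H l.+1 = (-1) ^+ l * oddr l ^+ 2 * coefA m l] and [H l + H l.+1 = (-1)
   ^+ l * oddr m * oddr l * coefA m l]. *)
pose H l := (-1) ^+ l * (oddr l * (m%:R + l%:R + 1) * coefA m l).
have HS l : H l.+1 = (-1) ^+ l * (oddr l * (m%:R - l%:R) * coefA m l).
  rewrite /H exprS -mulrA mulN1r -mulrN; congr (_ * _).
  rewrite (_ : m%:R + _ + _ = m%:R + l%:R + 2); last by rewrite mulrSr; ring.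
  by rewrite coefAS mulNr opprK.
transitivity (\sum_(l < m.+1) (H l + H l.+1) * ((-1) ^+ l * (oddr l)^-1 * g l)).
  apply: eq_bigr => l _; rewrite HS /H.
  transitivity ((-1) ^+ l * (-1) ^+ l * (oddr m * (coefA m l * g l))).
    by rewrite -expr2 sqrr_sign mul1r.
  have := oddr_neq0 l; rewrite {1}/oddr => o0; rewrite /oddr; field; exact: o0.
have H0 : H m.+1 = 0 by rewrite /H coefA_gt // !mulr0.
have /= <- := sum_starsum m (fun l => (-1) ^+ l / oddr l * g l) _ _ H H0
  (fun=> erefl) (fun=> erefl).
apply: eq_bigr => l _; rewrite mulrA; congr (_ * _).
by rewrite HS /H /oddr; ring.
Qed.

Lemma expands_three r g : expands r g ->
  expands (3%N :: r)
    (fun l => (oddr l)^-1 * starsum (fun i => oddr i ^- 2 * g i) l).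
Proof.
move=> /expands_cons; apply => m.
rewrite mulr_sumr.
(* Without the sign, sum and difference trade places: here [H l - H l.+1 = oddr l * coefA m l] and
   [H l + H l.+1 = oddr l ^+ 2 * coefA m l / oddr m]. *)
pose H l := oddr l * (m%:R + l%:R + 1) * coefA m l / oddr m.
have HS l : H l.+1 = - (oddr l * (m%:R - l%:R) * coefA m l) / oddr m.
  rewrite /H; congr (_ / _).
  rewrite (_ : m%:R + _ + _ = m%:R + l%:R + 2); last by rewrite mulrSr; ring.
  by rewrite coefAS mulNr.
have om0 := oddr_neq0 m.
transitivity (\sum_(l < m.+1) (H l + H l.+1) * (oddr l ^- 2 * g l)).
  apply: eq_bigr => l _; rewrite HS /H.
  have -> : m%:R = (oddr m - 1) / 2 by rewrite /oddr; field.
  have -> : l%:R = (oddr l - 1) / 2 by rewrite /oddr; field.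
  by field; rewrite om0 oddr_neq0.
have H0 : H m.+1 = 0 by rewrite /H coefA_gt // mulr0 mul0r.
have /= <- := sum_starsum m (fun l => oddr l ^- 2 * g l) _ _ H H0
  (fun=> erefl) (fun=> erefl).
apply: eq_bigr => l _; rewrite mulrA; congr (_ * _).
rewrite HS /H.
have -> : m%:R = (oddr m - 1) / 2 by rewrite /oddr; field.
by field; rewrite om0 oddr_neq0.
Qed.

(** * Error bound for the Leibniz series *)

(** With [p] the Taylor polynomial of the arctangent with [n] terms, [atan - p] vanishes at 0 and
    has derivative (-1)^n x^(2n) / (1 + x^2), of constant sign. The mean value theorem on [0, 1]
    gives the sign at 1. *)
Lemma leibniz_sign n :
  0 <= (-1) ^+ n * (pi / 4 - \sum_(i < n) (-1) ^+ i / oddr i).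
Proof.
pose p : {poly R} := \sum_(i < n) ((-1) ^+ i / oddr i) *: 'X^((2 * i).+1).
(* The derivative of [p] is a geometric sum of ratio -x^2. *)
have dp x : (1 + x ^+ 2) * p^`().[x] = 1 - (-1) ^+ n * (x ^+ 2) ^+ n.
  rewrite /p raddf_sum horner_sum /=.
  have -> : \sum_(i < n) (((-1) ^+ i / oddr i) *: 'X^((2 * i).+1))^`().[x] =
      \sum_(i < n) (- x ^+ 2) ^+ i.
    apply: eq_bigr => i _; rewrite derivZ derivXn !hornerE hornerMn hornerXn /=.
    rewrite -mulr_natl exprM -mulrA [X in _ * X = _]mulrA mulrSr natrM -/(oddr i).
    rewrite mulVf ?oddr_neq0 // mul1r.
    by rewrite (exprNn (x ^+ 2)).
  have := subrX1 (- x ^+ 2) n; rewrite (exprNn (x ^+ 2)) => h.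
  by rewrite -[RHS]opprB h; ring.
have dF (x : R) : x \in `]0, 1[%R ->
    is_derive x 1 (fun y => atan y - p.[y]) ((-1) ^+ n * (x ^+ 2) ^+ n / (1 + x ^+ 2)).
  move=> _; apply: is_derive_eq.
  have x0 : 1 + x ^+ 2 != 0 by rewrite lt0r_neq0 // ltr_wpDr // sqr_ge0.
  apply: (mulfI x0); rewrite mulrBr dp divff // [RHS]mulrC divfK //; ring.
have cF : {within `[0, 1], continuous (fun y : R => atan y - p.[y])}.
  apply: continuous_subspaceT => x.
  by apply: cvgB; [exact: continuous_atan|exact: continuous_horner].
have p0 : p.[0] = 0.
  rewrite /p horner_sum big1 // => i _.
  by rewrite hornerZ hornerXn expr0n mulr0.
have p1 : p.[1] = \sum_(i < n) (-1) ^+ i / oddr i.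
  rewrite /p horner_sum; apply: eq_bigr => i _.
  by rewrite hornerZ hornerXn expr1n mulr1.
have [c _] := MVT ltr01 dF cF.
rewrite atan1 atan0 p0 p1 subrr !subr0 mulr1 => ->.
rewrite mulrA mulrA -expr2 sqrr_sign mul1r.
by apply: divr_ge0; [apply: exprn_ge0|apply: addr_ge0 => //]; exact: sqr_ge0.
Qed.

(** Consecutive remainders have opposite signs and differ by a term of absolute value
    [(oddr n)^-1]. *)
Lemma leibniz_error n :
  `|pi / 4 - \sum_(i < n) (-1) ^+ i / oddr i| <= (oddr n)^-1.
Proof.
have h1 := leibniz_sign n; have := leibniz_sign n.+1.
rewrite big_ord_recr /= exprS mulN1r mulNr oppr_ge0.
set S := \sum_(i < n) _ in h1 *.
rewrite opprD addrA mulrBr [X in _ - X](_ : _ = (oddr n)^-1); last first.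
  by rewrite mulrA -expr2 sqrr_sign mul1r.
rewrite subr_le0; set d := pi / 4 - S in h1 *.
have -> : `|d| = `|(-1) ^+ n * d| by rewrite normrM normr_sign mul1r.
by rewrite ger0_norm.
Qed.

(** * Sign, size and partial sums of the coefficients *)

Lemma alternating_error (d : nat -> R) p n :
  (forall i, 0 <= d i) -> (forall i, d i.+1 <= d i) ->
  0 <= \sum_(i < n) (-1) ^+ i * d (p + i)%N <= d p.
Proof.
move=> d0 dS; elim: n p => [|n IH] p; first by rewrite big_ord0 lexx d0.
rewrite big_ord_recl /= mul1r addn0.
under eq_bigr do rewrite /bump /= add1n exprS mulN1r mulNr addnS -addSn.
rewrite sumrN; have /andP[h1 h2] := IH p.+1; have := dS p; lra.
Qed.

(** The ratio [(m - i) / (m + i + 2)] lies in [0, 1] for [i <= m]; the sign, the monotonicity and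
    the size of the coefficients all follow from this. *)
Lemma coefA_signS m i :
  oddr i.+1 * ((-1) ^+ i.+1 * coefA m i.+1) =
  (m%:R - i%:R) / (m%:R + i%:R + 2) * (oddr i * ((-1) ^+ i * coefA m i)).
Proof.
have h : m%:R + i%:R + 2 != 0 :> R.
  by apply: lt0r_neq0; have := ler0n R m; have := ler0n R i; lra.
apply: (mulfI h); rewrite mulrA [RHS]mulrA [_ * ((_ - _) / _)]mulrC divfK //.
have := coefAS m i; rewrite exprS.
move: (coefA m i.+1) (oddr i.+1) (coefA m i) (oddr i) ((-1) ^+ i) => x y z o s e.
transitivity (- s * (y * (m%:R + i%:R + 2) * x)); first by ring.
by rewrite e; ring.
Qed.

Lemma coefA_sign_ge0 m i : 0 <= (-1) ^+ i * coefA m i.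
Proof.
elim: i => [|i IH].
  rewrite mul1r; apply: prodr_ge0 => j _.
  by rewrite divr_ge0 ?exprn_ge0 // ?mulr_ge0 // ltW // oddr_gt0.
have [im|mi] := leqP m i; first by rewrite coefA_gt ?mulr0.
rewrite -(pmulr_rge0 _ (oddr_gt0 i.+1)) coefA_signS.
apply: mulr_ge0; last by rewrite mulr_ge0 // ltW // oddr_gt0.
by apply: divr_ge0; [rewrite subr_ge0 ler_nat ltnW|rewrite !addr_ge0].
Qed.

Lemma norm_coefA m i : `|coefA m i| = (-1) ^+ i * coefA m i.
Proof. by rewrite -(ger0_norm (coefA_sign_ge0 m i)) normrM normr_sign mul1r. Qed.

Lemma oddr_norm_coefA_nincr m i :
  oddr i.+1 * `|coefA m i.+1| <= oddr i * `|coefA m i|.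
Proof.
have A0 : 0 <= oddr i * `|coefA m i| by rewrite mulr_ge0 // ltW // oddr_gt0.
rewrite norm_coefA coefA_signS -norm_coefA ler_piMl //.
have m0 := ler0n R m; have i0 := ler0n R i.
by rewrite ler_pdivrMr; lra.
Qed.

Lemma norm_coefA_nincr m i : `|coefA m i.+1| <= `|coefA m i|.
Proof.
rewrite -(ler_pM2l (oddr_gt0 i)); apply: le_trans (oddr_norm_coefA_nincr m i).
by rewrite ler_wpM2r // /oddr mulrSr; lra.
Qed.

(** The full sum is 1, so the error is the tail, which alternates with nonincreasing absolute
    values. *)
Lemma sum_coefA_error m p : `|1 - \sum_(i < p) coefA m i| <= `|coefA m p|.
Proof.
have full n : (m < n)%N -> \sum_(i < n) coefA m i = 1.
  elim: n => // n IH; rewrite ltnS leq_eqVlt => /predU1P[<-|mn].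
    have := expands_nil m => /= ->.
    by apply: eq_bigr => i _; rewrite mulr1.
  by rewrite big_ord_recr /= IH // coefA_gt // addr0.
(* A tail of [m.+1] terms reaches past [m] whatever [p] is. *)
rewrite -(full (p + m.+1)%N) ?leq_addl // big_split_ord /= addrAC subrr add0r.
have -> : \sum_(i < m.+1) coefA m (p + i)%N =
    (-1) ^+ p * \sum_(i < m.+1) (-1) ^+ i * `|coefA m (p + i)%N|.
  rewrite mulr_sumr; apply: eq_bigr => i _.
  by rewrite norm_coefA exprD -mulrA (mulrCA ((-1) ^+ i)) !signrMK.
have /andP[h1 h2] := alternating_error (fun i => `|coefA m i|) p m.+1
  (fun i => normr_ge0 _) (norm_coefA_nincr m).
by rewrite normrM normr_sign mul1r ger0_norm.
Qed.

(** The error bound at [p = 1] gives [coefA m 0 - 1 <= - coefA m 1], and the ratio of consecutive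
    terms gives [- coefA m 1 <= coefA m 0 / 3]. *)
Lemma coefA0_le m : coefA m 0 <= 3 / 2.
Proof.
have := sum_coefA_error m 1; rewrite big_ord1 /= norm_coefA => h.
have := coefA_signS m 0; rewrite mul1r.
have -> : oddr 0 = 1 by rewrite /oddr mulr0 add0r.
have -> : oddr 1 = 3 by rewrite /oddr; lra.
have := coefA_sign_ge0 m 0; rewrite !mul1r addr0 subr0 => A0 e.
have : m%:R / (m%:R + 2) * coefA m 0 <= coefA m 0.
  rewrite ler_piMl //; have m0 := ler0n R m.
  by rewrite ler_pdivrMr; lra.
rewrite -e; move: h; rewrite ler_norml => /andP[]; lra.
Qed.

Lemma norm_coefA_le m i : `|coefA m i| <= 3 / 2 / oddr i.
Proof.
rewrite ler_pdivlMr ?oddr_gt0 // mulrC.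
elim: i => [|i IH]; last exact: le_trans (oddr_norm_coefA_nincr m i) IH.
by rewrite norm_coefA mul1r /oddr mulr0 add0r mul1r coefA0_le.
Qed.

(** * Limits of the coefficients *)

Lemma coefA0_nondecreasing : nondecreasing_seq (coefA ^~ 0%N).
Proof.
apply/nondecreasing_seqP => m.
have m0 := ler0n R m.
have A0 := coefA_sign_ge0 m 0; rewrite mul1r in A0.
(* The growth factor exceeds 1, as (2m+3)^2 = 4(m+1)(m+2) + 1. *)
have c0 : 0 < 4 * (m%:R + 1) * (m%:R + 2) :> R by rewrite !mulr_gt0 //; lra.
rewrite -(ler_pM2l c0); have := coefA_rec m 0; rewrite subr0 addr0 => <-.
rewrite ler_wpM2r // /oddr mulrSr; nra.
Qed.

Lemma cvg_shift_ratio i :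
  ((m%:R - i%:R) / (m%:R + i%:R + 2)) @[m --> \oo] --> (1 : R).
Proof.
have h : ((m%:R + i%:R + 2)^-1 : R) @[m --> \oo] --> (0 : R).
  have := @cvg_harmonic R; rewrite -(cvg_shiftn i.+1).
  apply: cvg_trans; apply: near_eq_cvg; near=> m.
  by rewrite /= /harmonic -addnS -addrA natrD -[i.+2]addn2 natrD.
have -> : (fun m : nat => (m%:R - i%:R) / (m%:R + i%:R + 2) : R) =
          (fun m => 1 - (2 * i%:R + 2) * (m%:R + i%:R + 2)^-1).
  apply/funext => m; field.
  by apply: lt0r_neq0; have := ler0n R m; have := ler0n R i; lra.
rewrite -[X in _ --> X](subr0 1) -[in X in _ --> X](mulr0 (2 * i%:R + 2)).
by apply: cvgB; [exact: cvg_cst|apply: cvgMl_tmp].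
Unshelve. all: by end_near. Qed.

Lemma cvg_coefA_lim0 i :
  coefA m i @[m --> \oo] --> (-1) ^+ i / oddr i * limn (coefA ^~ 0%N).
Proof.
elim: i => [|i IH].
  rewrite /oddr mulr0 add0r invr1 !mul1r.
  apply: nondecreasing_is_cvgn coefA0_nondecreasing _.
  by exists (3 / 2) => _ [m _ <-]; exact: coefA0_le.
set l := limn _ in IH *.
have -> : (-1) ^+ i.+1 / oddr i.+1 * l =
    1 * (- (oddr i / oddr i.+1)) * ((-1) ^+ i / oddr i * l).
  by rewrite exprS; field; rewrite !oddr_neq0.
have -> : coefA ^~ i.+1 = (fun m => ((m%:R - i%:R) / (m%:R + i%:R + 2))
     * (- (oddr i / oddr i.+1)) * coefA m i).
  apply/funext => m; rewrite {1}/coefA -/(coefA m i); field.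
  rewrite !oddr_neq0 /=.
  by apply: lt0r_neq0; have := ler0n R m; have := ler0n R i; lra.
by apply: cvgM IH; apply: cvgMr_tmp; exact: cvg_shift_ratio.
Qed.

Lemma cvg_ord_sum (F : nat -> nat -> R) (f : nat -> R) n :
  (forall i, F m i @[m --> \oo] --> f i) ->
  \sum_(i < n) F m i @[m --> \oo] --> \sum_(i < n) f i.
Proof. by move=> Ff; apply: cvg_big => //; exact: add_continuous. Qed.

(** With S_p the Leibniz partial sum, letting [m] grow in [sum_coefA_error] for fixed [p] gives |1 -
    l S_p| <= l / (2p+1). Together with [leibniz_error] this bounds |1 - l pi / 4| by 2 l / (2p+1)
    for every [p]. *)
Lemma lim_coefA0 : limn (coefA ^~ 0%N) = 4 / pi :> R.
Proof.
set l := limn _.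
have l0 : 0 <= l.
  have := cvg_coefA_lim0 0; rewrite /oddr mulr0 add0r invr1 !mul1r -/l => cl.
  apply: (ler_cvg_to (cvg_cst 0) cl); near=> m.
  by have := coefA_sign_ge0 m 0; rewrite mul1r.
have err p : `|1 - l * (pi / 4)| <= 2 * l / oddr p.
  have h : `|1 - \sum_(i < p) (-1) ^+ i / oddr i * l| <= l / oddr p.
    have -> : l / oddr p = `|(-1) ^+ p / oddr p * l|.
      rewrite !normrM normr_sign mul1r normfV.
      by rewrite (gtr0_norm (oddr_gt0 p)) (ger0_norm l0) mulrC.
    have cS : `|1 - \sum_(i < p) coefA m i| @[m --> \oo] -->
        `|1 - \sum_(i < p) (-1) ^+ i / oddr i * l|.
      apply: cvg_norm; apply: cvgB; first exact: cvg_cst.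
      exact: (cvg_ord_sum coefA _ p cvg_coefA_lim0).
    apply: (ler_cvg_to cS (cvg_norm (cvg_coefA_lim0 p))).
    by near=> m; exact: sum_coefA_error.
  rewrite -mulr_suml mulrC in h.
  have := leibniz_error p; set S := \sum_(i < p) _ in h * => h2.
  have -> : 1 - l * (pi / 4) = (1 - l * S) - l * (pi / 4 - S) by ring.
  apply: le_trans (ler_normB _ _) _.
  rewrite normrM (ger0_norm l0) -mulrA mulr_natl mulr2n lerD //.
  by rewrite ler_wpM2l.
have : `|1 - l * (pi / 4)| <= 0.
  have h : (2 * l / oddr p : R) @[p --> \oo] --> (0 : R).
    rewrite -[X in _ --> X](mulr0 (2 * l)); apply: cvgMl_tmp.
    have := @cvg_harmonic R.
    apply: squeeze_cvgr; last exact: cvg_cst.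
    near=> p; rewrite invr_ge0 ltW ?oddr_gt0 //=.
    rewrite /harmonic lef_pV2 ?posrE ?oddr_gt0 // /oddr mulrSr.
    by have := ler0n R p; lra.
  by apply: (ler_cvg_to (cvg_cst _) h); near=> p; exact: err.
rewrite normr_le0 subr_eq0 => /eqP e.
have p0 : pi != 0 :> R by rewrite lt0r_neq0 // pi_gt0.
move: (pi : R) p0 e => p p0 e.
have -> : 4 / p = 4 / p * (l * (p / 4)) by rewrite -e mulr1.
by field.
Unshelve. all: by end_near. Qed.

Lemma cvg_coefA i : coefA m i @[m --> \oo] --> 4 / pi * ((-1) ^+ i / oddr i).
Proof. by rewrite mulrC -lim_coefA0; exact: cvg_coefA_lim0. Qed.

(** * Dominated convergence for the expansions *)

Lemma series_rec (F u : nat -> R) : F 0%N = 0 ->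
  (forall n, F n.+1 = F n + u n) -> series u = F.
Proof.
move=> F0 FS; apply/funext; elim=> [|n IH]; first by rewrite /series /= big_geq.
by rewrite FS -IH /series /= big_nat_recr.
Qed.

Lemma tannery (F : nat -> nat -> R) (f M : nat -> R) (l : R) :
  (forall i, F m i @[m --> \oo] --> f i) ->
  (forall m i, `|F m i| <= M i) ->
  cvgn (series M) -> series f @ \oo --> l ->
  \sum_(i < m.+1) F m i @[m --> \oo] --> l.
Proof.
move=> Ff FM cM cf.
have fM i : `|f i| <= M i.
  have cM' : (fun m : nat => M i) @ \oo --> M i by exact: cvg_cst.
  by apply: (ler_cvg_to (cvg_norm (Ff i)) cM'); near=> m; exact: FM.
have M0 i : 0 <= M i by exact: le_trans (normr_ge0 _) (fM i).
suff d0 : \sum_(i < m.+1) (F m i - f i) @[m --> \oo] --> (0 : R).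
  rewrite -[l]add0r.
  rewrite (_ : (fun m => _) = (fun m => \sum_(i < m.+1) (F m i - f i) + series f m.+1)).
    by apply: cvgD d0 _; rewrite cvg_shiftS.
  by apply/funext => m; rewrite sumrB /series /= big_mkord subrK.
apply/cvgrPdist_le => e e0.
(* The tail of [M] is kept below [e / 4] because [F m i - f i] is dominated by [2 * M i]; the first
   [N] terms get the other [e / 2]. *)
have e4 : 0 < e / 4 by rewrite divr_gt0.
have [N _ hN] : \forall n \near \oo, `|limn (series M) - series M n| <= e / 4.
  by move/cvgrPdist_le: cM; apply.
have cN : \sum_(i < N) `|F m i - f i| @[m --> \oo] --> (0 : R).
  have := cvg_ord_sum (fun m i => `|F m i - f i|) (fun=> 0) N.
  rewrite (big1 _ xpredT) //; apply => i.
  by apply/norm_cvg0P/subr_cvg0; exact: Ff.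
have e2 : 0 < e / 2 by rewrite divr_gt0.
near=> m.
rewrite sub0r normrN; apply: le_trans (ler_norm_sum _ _ _) _.
have Nm : (N <= m.+1)%N by apply: leqW; near: m; exact: nbhs_infty_ge.
rewrite -(big_mkord xpredT (fun i => `|F m i - f i|)) (big_cat_nat _ Nm) //=.
rewrite big_mkord [leRHS](_ : e = e / 2 + e / 2); last by field.
apply: lerD.
  have : `|0 - \sum_(i < N) `|F m i - f i| | <= e / 2.
    by near: m; move/cvgrPdist_le: cN; apply.
  by rewrite sub0r normrN; apply: le_trans (ler_norm _).
apply: (@le_trans _ _ (\sum_(N <= i < m.+1) 2 * M i)).
  apply: ler_sum => i _; apply: le_trans (ler_normB _ _) _.
  by rewrite mulr_natl mulr2n lerD.
rewrite -mulr_sumr.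
rewrite -sub_series_geq //.
have := hN N (leqnn N); rewrite ler_norml => /andP[_].
have : series M m.+1 <= limn (series M).
  exact: nondecreasing_cvgn_le (nondecreasing_series (fun i _ _ => M0 i)) cM _.
lra.
Unshelve. all: by end_near. Qed.

Lemma is_cvg_series_oddr : cvgn (series (fun i => oddr i ^- 2)).
Proof.
have o2 i : 0 <= oddr i ^- 2 by rewrite invr_ge0 sqr_ge0.
apply: nondecreasing_is_cvgn.
  by apply: nondecreasing_series => i _ _.
exists 3 => _ [n _ <-].
(* A telescoping majorant: 1 / x^2 <= 2 / x - 2 / (x + 2) for x >= 1. *)
have : series (fun i => oddr i ^- 2) n <= 3 - 2 / oddr n.
  rewrite /series /= big_mkord; elim: n => [|n IH].
    by rewrite big_ord0 /oddr mulr0 add0r; lra.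
  rewrite big_ord_recr /=; apply: le_trans (lerD IH (lexx _)) _.
  have n0 := ler0n R n.
  have -> : oddr n.+1 = oddr n + 2 by rewrite /oddr mulrSr; ring.
  have : 1 <= oddr n by rewrite /oddr; lra.
  move: (oddr n) => x x1.
  rewrite -subr_ge0.
  have -> : 3 - 2 / (x + 2) - (3 - 2 / x + x ^- 2) =
      (3 * x - 2) * (x ^- 2 * (x + 2)^-1).
    by field; apply/andP; split; apply: lt0r_neq0; lra.
  apply: mulr_ge0; first by lra.
  by apply: mulr_ge0; rewrite invr_ge0 ?sqr_ge0 //; lra.
have : 0 <= 2 / oddr n by rewrite divr_ge0 // ltW // oddr_gt0.
lra.
Qed.

Lemma expands_cvg s g (C l : R) :
  expands s g -> (forall i, `|g i| <= C / oddr i) ->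
  series (fun i => 4 / pi * ((-1) ^+ i / oddr i) * g i) @ \oo --> l ->
  tstarN R s @ \oo --> l.
Proof.
(* The expansion describes the truncation at [m.+1], hence the shift. *)
move=> sg gC cl; rewrite -cvg_shiftS.
rewrite (_ : [sequence _]_n = (fun m => \sum_(i < m.+1) coefA m i * g i)); last first.
  by apply/funext => m; exact: sg.
apply: (tannery (fun m i => coefA m i * g i) _ (fun i => 3 / 2 * C * oddr i ^- 2) _ _ _ _ cl).
- by move=> i; apply: cvgMr_tmp; exact: cvg_coefA.
- move=> m i; rewrite normrM.
  have -> : 3 / 2 * C * oddr i ^- 2 = 3 / 2 / oddr i * (C / oddr i).
    by field; rewrite oddr_neq0.
  by apply: ler_pM => //; exact: norm_coefA_le.
- have -> : series (fun i => 3 / 2 * C * oddr i ^- 2) =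
      (fun n => 3 / 2 * C * series (fun i => oddr i ^- 2) n).
    by apply/funext => n; rewrite /series /= mulr_sumr.
  by apply: cvgP; apply: cvgMl_tmp; exact: is_cvg_series_oddr.
Qed.

(** * Growth and convergence of truncated alternating t-sums *)

Definition barsign (b : bool) (i : nat) : R := if b then (-1) ^+ i.+1 else 1.

Lemma tN0 s b r : tN R ((s, b) :: r) 0 = 0.
Proof. by rewrite /= big_geq. Qed.

Lemma tNS s b r n : tN R ((s, b) :: r) n.+1 =
  tN R ((s, b) :: r) n + barsign b n * oddr n ^- s * tN R r n.
Proof. by rewrite /= big_nat_recr //= oddrE. Qed.

Lemma tN1 s t l : tN R [:: (s, t)] l.+1 = tN R [:: (s, t)] l + barsign t l * oddr l ^- s.
Proof. by rewrite tNS mulr1. Qed.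

Lemma norm_barsign b i : `|barsign b i| = 1.
Proof. by case: b; rewrite /barsign ?normr_sign ?normr1. Qed.

Lemma oddr_invX_le s k i : (k <= s)%N -> oddr i ^- s <= oddr i ^- k.
Proof.
move=> ks; rewrite lef_pV2 ?posrE ?exprn_gt0 ?oddr_gt0 //.
by apply: ler_weXn2l => //; rewrite /oddr; have := ler0n R i; lra.
Qed.

Lemma oddr_invX_norm s l : `|oddr l ^- s| <= 1.
Proof.
rewrite ger0_norm; last by rewrite invr_ge0 exprn_ge0 // ltW // oddr_gt0.
by have := oddr_invX_le s 0 l (leq0n s); rewrite expr0 invr1.
Qed.

(** Drop the signs, lower every exponent to 1, and enlarge the decreasing tuples to all tuples. *)
Lemma norm_tN_le (r : seq (nat * bool)) n : all (fun x => 0 < x.1)%N r ->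
  `|tN R r n| <= (\sum_(i < n) (oddr i)^-1) ^+ size r.
Proof.
have E0 k : 0 <= \sum_(i < k) (oddr i)^-1.
  by apply: sumr_ge0 => i _; rewrite invr_ge0 ltW // oddr_gt0.
elim: r n => [|[s b] r IH] n; first by rewrite normr1 expr0.
move=> /andP[s0 r0]; rewrite [size _]/=; elim: n => [|n IHn].
  by rewrite tN0 normr0 exprn_ge0.
rewrite tNS.
apply: le_trans (ler_normD _ _) _; rewrite big_ord_recr [X in _ <= X]/= exprSr mulrDr.
have El : \sum_(i < n) (oddr i)^-1 <= \sum_(i < n) (oddr i)^-1 + (oddr n)^-1.
  by rewrite lerDl invr_ge0 ltW // oddr_gt0.
have Ek k : (\sum_(i < n) (oddr i)^-1) ^+ k <=
    (\sum_(i < n) (oddr i)^-1 + (oddr n)^-1) ^+ k.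
  by apply: lerXn2r; [exact: E0|exact: le_trans (E0 n) El|exact: El].
apply: lerD.
  apply: le_trans IHn _; rewrite exprSr; exact: ler_wpM2r.
rewrite normrM mulrC; apply: ler_pM => //.
  exact: le_trans (IH n r0) (Ek _).
rewrite normrM norm_barsign mul1r ger0_norm; first exact: (oddr_invX_le s 1 n).
by rewrite invr_ge0 exprn_ge0 // ltW // oddr_gt0.
Qed.

(** A crude linear bound on logarithmic growth; a leading exponent at least 3 absorbs it and leaves
    the summable [oddr i ^- 2]. *)
Lemma norm_tN_le_oddr (r : seq (nat * bool)) n :
  all (fun x => 0 < x.1)%N r -> (size r <= 2)%N -> `|tN R r n| <= oddr n.
Proof.
move=> r0 r2; apply: le_trans (norm_tN_le r n r0) _.
have n0 := ler0n R n.
have E0 k : 0 <= \sum_(i < k) (oddr i)^-1.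
  by apply: sumr_ge0 => i _; rewrite invr_ge0 ltW // oddr_gt0.
have o1 k : 1 <= oddr k by rewrite /oddr; have := ler0n R k; lra.
have i1 k : (oddr k)^-1 <= 1 by rewrite invf_le1 ?oddr_gt0.
have E1 k : \sum_(i < k) (oddr i)^-1 <= k%:R.
  elim: k => [|k IH]; first by rewrite big_ord0.
  by rewrite big_ord_recr /= mulrSr lerD.
(* With [x = (oddr k)^-1], the square grows by 2 E x + x^2 <= 2 k x + x = 1. *)
have E2 : (\sum_(i < n) (oddr i)^-1) ^+ 2 <= 2 * n%:R.
  elim: n {n0} => [|k IH]; first by rewrite big_ord0 expr0n mulr0.
  rewrite big_ord_recr /= (mulrSr _ k); move: IH (E0 k) (E1 k) (i1 k).
  have : k%:R * (oddr k)^-1 = (1 - (oddr k)^-1) / 2.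
    have := oddr_neq0 k; have -> : k%:R = (oddr k - 1) / 2 by rewrite /oddr; field.
    by move=> ?; field.
  have : 0 <= (oddr k)^-1 by rewrite invr_ge0 ltW // oddr_gt0.
  move: (\sum_(i < k) _) (oddr k)^-1 (k%:R) => E x K x0 Kx IH EE EK x1.
  have : E * x <= K * x by rewrite ler_wpM2r.
  have : x * x <= x by rewrite ler_piMr.
  by rewrite !expr2; lra.
case: (size r) r2 => [|[|[|//]]] _.
- by rewrite expr0.
- by rewrite expr1; have := E1 n; rewrite /oddr; lra.
- by have := E2; rewrite /oddr; lra.
Qed.

Lemma is_cvg_tN s b (r : seq (nat * bool)) : (3 <= s)%N ->
  all (fun x => 0 < x.1)%N r -> (size r <= 2)%N -> cvgn (tN R ((s, b) :: r)).
Proof.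
move=> s3 r0 r2.
have -> : tN R ((s, b) :: r) = series (fun i => barsign b i * oddr i ^- s * tN R r i).
  by apply/esym/series_rec; [exact: tN0|move=> n; exact: tNS].
apply: normed_cvg; apply: series_le_cvg is_cvg_series_oddr => [i|i|i].
- exact: normr_ge0.
- by rewrite invr_ge0 sqr_ge0.
rewrite /= !normrM norm_barsign mul1r.
have -> : oddr i ^- 2 = oddr i ^- 3 * oddr i by field; rewrite oddr_neq0.
apply: ler_pM => //; last exact: norm_tN_le_oddr.
rewrite ger0_norm; first exact: oddr_invX_le.
by rewrite invr_ge0 exprn_ge0 // ltW // oddr_gt0.
Qed.

Lemma cvg_altt s b (r : seq (nat * bool)) : (3 <= s)%N ->
  all (fun x => 0 < x.1)%N r -> (size r <= 2)%N ->
  tN R ((s, b) :: r) @ \oo --> altt R ((s, b) :: r).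
Proof. exact: is_cvg_tN. Qed.

Lemma starsumE (F u : nat -> R) l : F 0%N = 0 ->
  (forall n, F n.+1 = F n + u n) -> starsum u l = 2 * F l + u l.
Proof.
move=> F0 FS; have sumF n : \sum_(i < n) u i = F n.
  by rewrite -(series_rec _ _ F0 FS) /series /= big_mkord.
by rewrite /starsum !sumF FS; ring.
Qed.

Lemma norm_comb_le (x y z w : R) (l : nat) : `|x| <= oddr l -> `|y| <= oddr l ->
  `|z| <= oddr l -> `|w| <= 1 -> `|4 * x + 2 * y + 2 * z + w| <= 9 * oddr l.
Proof.
move=> hx hy hz hw; have o1 : 1 <= oddr l by rewrite /oddr; have := ler0n R l; lra.
move: hx hy hz hw; rewrite !ler_norml; lra.
Qed.

(** * The two families of indices *)

Section FixedIndices.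
Variables (a b c : nat).
Hypothesis a_gt0 : (0 < a)%N.

(** The weights 4, 2, 2, 1 come from expanding two nested [starsum]s, each of the form 2 F + u. *)
Definition coef13 (l : nat) : R :=
  4 * tN R [:: ((2*b+2)%N, true); ((2*c+2)%N, false)] l
  + 2 * tN R [:: ((2*b+2*c+4)%N, true)] l
  + 2 * ((-1) ^+ l.+1 * oddr l ^- (2*b+2) * tN R [:: ((2*c+2)%N, false)] l)
  + (-1) ^+ l.+1 * oddr l ^- (2*b+2*c+4).

Definition coef11 (l : nat) : R :=
  4 * tN R [:: ((2*b+1)%N, false); ((2*c+1)%N, true)] l
  + 2 * tN R [:: ((2*b+2*c+2)%N, true)] l
  + 2 * (oddr l ^- (2*b+1) * tN R [:: ((2*c+1)%N, true)] l)
  + (-1) ^+ l.+1 * oddr l ^- (2*b+2*c+2).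

(** The split-off sign meets the [(-1) ^+ l] in the limit of [coefA]; their product -1 is the source
    of the minus signs in the theorem. *)
Definition coef (q : nat -> R) (l : nat) : R :=
  oddr l ^- (2 * a) * ((-1) ^+ l.+1 * q l).

Lemma expands13 :
  expands (nseq a 2%N ++ 1%N :: nseq b 2%N ++ 3%N :: nseq c 2%N) (coef coef13).
Proof.
have := expands_nseq_two a _ _ (expands_one _ _ (expands_nseq_two b _ _
  (expands_three _ _ (expands_nseq_two c _ _ expands_nil)))).
rewrite cats0 => h m; rewrite h; apply: eq_bigr => l _; congr (_ * _).
rewrite /coef; congr (_ * _).
have inner i : starsum (fun j => oddr j ^- 2 * (oddr j ^- (2 * c) * 1)) i =
    2 * tN R [:: ((2*c+2)%N, false)] i + oddr i ^- (2*c+2).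
  rewrite (starsumE (tN R [:: ((2*c+2)%N, false)])) ?tN0 // => [|n].
    by rewrite -!exprVn exprD mulr1 [X in _ + X]mulrC.
  by rewrite tN1 /barsign mul1r -!exprVn exprD mulr1 [X in _ + X]mulrC.
(* The overall minus turns [(-1) ^+ j] into the sign [(-1) ^+ j.+1] carried by a barred entry. *)
rewrite (starsumE (fun n =>
    - (2 * tN R [:: ((2*b+2)%N, true); ((2*c+2)%N, false)] n
       + tN R [:: ((2*b+2*c+4)%N, true)] n))).
- rewrite inner /coef13 exprS -!exprVn !exprD.
  move: (tN R _ _) (tN R _ _) (tN R _ _) ((-1) ^+ l) => T1 T2 T3 e.
  by ring.
- by rewrite !tN0 mulr0 addr0 oppr0.
- move=> n; rewrite inner tN1 tNS /barsign exprS -!exprVn !exprD.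
  move: (tN R _ _) (tN R _ _) (tN R _ _) ((-1) ^+ n) => T1 T2 T3 e.
  by ring.
Qed.

Lemma expands11 :
  expands (nseq a 2%N ++ 1%N :: nseq b 2%N ++ 1%N :: nseq c 2%N) (coef coef11).
Proof.
have := expands_nseq_two a _ _ (expands_one _ _ (expands_nseq_two b _ _
  (expands_one _ _ (expands_nseq_two c _ _ expands_nil)))).
rewrite cats0 => h m; rewrite h; apply: eq_bigr => l _; congr (_ * _).
rewrite /coef; congr (_ * _).
have inner i : starsum (fun j => (-1) ^+ j / oddr j * (oddr j ^- (2 * c) * 1)) i =
    - 2 * tN R [:: ((2*c+1)%N, true)] i + (-1) ^+ i * oddr i ^- (2*c+1).
  rewrite (starsumE (fun n => - tN R [:: ((2*c+1)%N, true)] n)) ?tN0 ?oppr0 // => [|n].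
    by rewrite -!exprVn exprD; ring.
  by rewrite tN1 /barsign exprS -!exprVn exprD; ring.
(* The signs of the two prepended 1s cancel in the product with the depth-one sum, so [2*b+1] is
   unbarred. *)
rewrite (starsumE (fun n =>
    - (2 * tN R [:: ((2*b+1)%N, false); ((2*c+1)%N, true)] n
       + tN R [:: ((2*b+2*c+2)%N, true)] n))).
- rewrite inner /coef11 exprS -!exprVn !exprD.
  move: (tN R _ _) (tN R _ _) (tN R _ _) => T1 T2 T3.
  by rewrite -signr_odd; case: (odd l); rewrite ?expr0 ?expr1; ring.
- by rewrite !tN0 mulr0 addr0 oppr0.
- move=> n; rewrite inner tN1 tNS /barsign exprS -!exprVn !exprD.
  move: (tN R _ _) (tN R _ _) (tN R _ _) => T1 T2 T3.
  by rewrite -signr_odd; case: (odd n); rewrite ?expr0 ?expr1; ring.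
Qed.

(** Since [a] is positive, the prefix contributes at least [oddr l ^- 2]-decay, turning linear
    growth into [O(1 / oddr l)]. The constant 9 is 4 + 2 + 2 + 1. *)
Lemma coef_le (q : nat -> R) l :
  `|q l| <= 9 * oddr l -> `|coef q l| <= 9 / oddr l.
Proof.
move=> ql; rewrite /coef !normrM normr_sign mul1r.
have -> : 9 / oddr l = oddr l ^- 2 * (9 * oddr l) by field; rewrite oddr_neq0.
apply: ler_pM => //; rewrite ger0_norm.
  by apply: oddr_invX_le; rewrite -{1}[2%N]muln1 leq_mul2l.
by rewrite invr_ge0 exprn_ge0 // ltW // oddr_gt0.
Qed.

Lemma coef13_le l : `|coef coef13 l| <= 9 / oddr l.
Proof.
apply/coef_le/norm_comb_le.
- by apply: norm_tN_le_oddr => //=; rewrite !addn2.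
- by apply: norm_tN_le_oddr => //=; rewrite addn4.
- rewrite !normrM normr_sign mul1r -[leRHS]mul1r; apply: ler_pM => //.
    exact: oddr_invX_norm.
  by apply: norm_tN_le_oddr => //=; rewrite addn2.
- by rewrite normrM normr_sign mul1r oddr_invX_norm.
Qed.

Lemma coef11_le l : `|coef coef11 l| <= 9 / oddr l.
Proof.
apply/coef_le/norm_comb_le.
- by apply: norm_tN_le_oddr => //=; rewrite !addn1.
- by apply: norm_tN_le_oddr => //=; rewrite addn2.
- rewrite normrM -[leRHS]mul1r; apply: ler_pM => //.
    exact: oddr_invX_norm.
  by apply: norm_tN_le_oddr => //=; rewrite addn1.
- by rewrite normrM normr_sign mul1r oddr_invX_norm.
Qed.

Lemma tstar13_cvg :
  tstarN R (nseq a 2%N ++ 1%N :: nseq b 2%N ++ 3%N :: nseq c 2%N) n @[n --> \oo] -->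
     - (4 / pi) * altt R [:: ((2*a+2*b+2*c+5)%N, true)]
     - (8 / pi) * altt R [:: ((2*a+1)%N, false); ((2*b+2*c+4)%N, true)]
     - (8 / pi) * altt R [:: ((2*a+2*b+3)%N, true); ((2*c+2)%N, false)]
     - (16 / pi) * altt R [:: ((2*a+1)%N, false); ((2*b+2)%N, true); ((2*c+2)%N, false)].
Proof.
apply: (expands_cvg _ _ 9 _ expands13 coef13_le).
(* The limiting summand is -(4 / pi) [oddr n ^- (2*a+1)] times [coef13 n]: each of its four terms is
   the increment of one truncated t-sum. *)
rewrite (series_rec (fun n => - (4 / pi) * tN R [:: ((2*a+2*b+2*c+5)%N, true)] n
     - (8 / pi) * tN R [:: ((2*a+1)%N, false); ((2*b+2*c+4)%N, true)] n
     - (8 / pi) * tN R [:: ((2*a+2*b+3)%N, true); ((2*c+2)%N, false)] n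
     - (16 / pi) * tN R [:: ((2*a+1)%N, false); ((2*b+2)%N, true); ((2*c+2)%N, false)] n)).
(* All leading exponents are at least 3 because [a] is positive. *)
- by apply: cvgB; first apply: cvgB; first apply: cvgB;
    apply: cvgMl_tmp; apply: cvg_altt => //=; lia.
- by rewrite !tN0 !mulr0 !subr0.
- move=> n; rewrite tN1 !(tNS (2 * a + 1)) (tNS (2 * a + 2 * b + 3)).
  rewrite /coef /coef13 /barsign -!exprVn !exprD (exprS (-1) n).
  move: (pi^-1 : R) (tN R _ _) (tN R _ _) (tN R _ _) (tN R _ _) (tN R _ _)
    (tN R _ _) (tN R _ _) => p T1 T2 T3 T4 T5 T6 T7.
  by rewrite -signr_odd; case: (odd n); rewrite ?expr0 ?expr1; ring.
Qed.

Lemma tstar11_cvg :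
  tstarN R (nseq a 2%N ++ 1%N :: nseq b 2%N ++ 1%N :: nseq c 2%N) n @[n --> \oo] -->
     - (4 / pi) * altt R [:: ((2*a+2*b+2*c+3)%N, true)]
     - (8 / pi) * altt R [:: ((2*a+1)%N, false); ((2*b+2*c+2)%N, true)]
     - (8 / pi) * altt R [:: ((2*a+2*b+2)%N, false); ((2*c+1)%N, true)]
     - (16 / pi) * altt R [:: ((2*a+1)%N, false); ((2*b+1)%N, false); ((2*c+1)%N, true)].
Proof.
apply: (expands_cvg _ _ 9 _ expands11 coef11_le).
rewrite (series_rec (fun n => - (4 / pi) * tN R [:: ((2*a+2*b+2*c+3)%N, true)] n
     - (8 / pi) * tN R [:: ((2*a+1)%N, false); ((2*b+2*c+2)%N, true)] n
     - (8 / pi) * tN R [:: ((2*a+2*b+2)%N, false); ((2*c+1)%N, true)] n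
     - (16 / pi) * tN R [:: ((2*a+1)%N, false); ((2*b+1)%N, false); ((2*c+1)%N, true)] n)).
- by apply: cvgB; first apply: cvgB; first apply: cvgB;
    apply: cvgMl_tmp; apply: cvg_altt => //=; lia.
- by rewrite !tN0 !mulr0 !subr0.
- move=> n; rewrite tN1 !(tNS (2 * a + 1)) (tNS (2 * a + 2 * b + 2)).
  rewrite /coef /coef11 /barsign -!exprVn !exprD (exprS (-1) n).
  move: (pi^-1 : R) (tN R _ _) (tN R _ _) (tN R _ _) (tN R _ _) (tN R _ _)
    (tN R _ _) (tN R _ _) => p T1 T2 T3 T4 T5 T6 T7.
  (* Splitting on parity makes the sign an explicit 1 or -1, so that its square simplifies. *)
  by rewrite -signr_odd; case: (odd n); rewrite ?expr0 ?expr1; ring.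
Qed.

End FixedIndices.
End MultipleTStar.

Theorem theorem4p6 (R : realType) (a b c : nat) (ha : (0 < a)%N) :
  (tstarN R (nseq a 2%N ++ 1%N :: nseq b 2%N ++ 3%N :: nseq c 2%N) n @[n --> \oo] -->
     - (4 / pi) * altt R [:: ((2*a+2*b+2*c+5)%N, true)]
     - (8 / pi) * altt R [:: ((2*a+1)%N, false); ((2*b+2*c+4)%N, true)]
     - (8 / pi) * altt R [:: ((2*a+2*b+3)%N, true); ((2*c+2)%N, false)]
     - (16 / pi) * altt R [:: ((2*a+1)%N, false); ((2*b+2)%N, true); ((2*c+2)%N, false)])
  /\
  (tstarN R (nseq a 2%N ++ 1%N :: nseq b 2%N ++ 1%N :: nseq c 2%N) n @[n --> \oo] -->
     - (4 / pi) * altt R [:: ((2*a+2*b+2*c+3)%N, true)]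
     - (8 / pi) * altt R [:: ((2*a+1)%N, false); ((2*b+2*c+2)%N, true)]
     - (8 / pi) * altt R [:: ((2*a+2*b+2)%N, false); ((2*c+1)%N, true)]
     - (16 / pi) * altt R [:: ((2*a+1)%N, false); ((2*b+1)%N, false); ((2*c+1)%N, true)]).
Proof. by split; [exact: tstar13_cvg|exact: tstar11_cvg]. Qed.
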